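(* In the setting below, assume $\|\nabla f_i(x)\|\le G_i$ for all $x$ and $i$, and that $\psi$ satisfies the $\mu_\psi$-condition with $\mu_\psi>0$. For any $m\in\mathbb N$, with stepsizes $\eta_k=\frac{m}{n\mu_\psi k}$ for $k\in[K]$ and arbitrary permutations $\sigma_k$, there is an absolute constant $C>0$ such that $$F(x_{K+1})-F_*\le C\left(\frac{\mu_\psi D^2}{\binom{K+m}{m}}+\frac{\bar G^2m\log K}{\mu_\psi K}\right).$$
   Context: Setting. Let $n,d\in\mathbb N$, let $f_1,\dots,f_n:\mathbb R^d\to\mathbb R$ be convex, $f=\frac1n\sum_{i=1}^nf_i$, let $\psi:\mathbb R^d\to\mathbb R\cup\{+\infty\}$ be proper, closed and convex, and $F=f+\psi$. For a convex function $g$, $\nabla g(x)$ denotes an element of $\partial g(x)$ (for each $f_i$ a fixed selection of subgradients, the same one used in the algorithm), and $B_g(x,y)=g(x)-g(y)-\langle\nabla g(y),x-y\rangle$. The $\mu_\psi$-condition: $\mu_\psi\ge0$ and $B_\psi(x,y)\ge\frac{\mu_\psi}{2}\|x-y\|^2$ for all $x,y$ with $\partial\psi(y)\neq\emptyset$ and every choice of $\nabla\psi(y)\in\partial\psi(y)$. Assume there is $x_*\in\mathbb R^d$ with $F(x_* )=\inf_{x}F(x)\in\mathbb R$; write $F_*=F(x_* )$. Proximal shuffling gradient method: given $x_1\in\mathrm{dom}\,\psi$, a number of epochs $K\ge2$ and stepsizes $\eta_k>0$, for $k=1,\dots,K$: choose a permutation $\sigma_k=(\sigma_k^1,\dots,\sigma_k^n)$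 of $[n]=\{1,\dots,n\}$; set $x_k^1=x_k$ and $x_k^{i+1}=x_k^i-\eta_k\nabla f_{\sigma_k^i}(x_k^i)$ for $i=1,\dots,n$; set $x_{k+1}=\arg\min_{x\in\mathbb R^d}\{n\psi(x)+\frac{1}{2\eta_k}\|x-x_k^{n+1}\|^2\}$. $D=\|x_*-x_1\|$; $\|\cdot\|$ is the Euclidean norm; $\log$ is natural. Lipschitz condition: constants $G_i>0$ with $\|\nabla f_i(x)\|\le G_i$ for all $x\in\mathbb R^d$, $i\in[n]$ (for every subgradient); $\bar G=\frac1n\sum_{i=1}^nG_i$. *)

(* Defs.v *)
From HB Require Import structures.
From mathcomp Require Import all_boot all_order all_algebra all_fingroup.
From mathcomp Require Import all_classical all_reals all_analysis.
Set Implicit Arguments. Unset Strict Implicit. Unset Printing Implicit Defensive.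
Import Order.TTheory GRing.Theory Num.Theory numFieldNormedType.Exports.
Local Open Scope ring_scope.

Section Defs.
Variables (R : realType) (d : nat).
Notation vec := 'rV[R]_d.

Definition dotv (u v : vec) : R := \sum_(j < d) u ord0 j * v ord0 j.
Definition enorm (v : vec) : R := Num.sqrt (dotv v v).

Definition convex_fun (f : vec -> R) : Prop :=
  forall (x y : vec) (t : R), 0 <= t <= 1 ->
    f (t *: x + (1 - t) *: y) <= t * f x + (1 - t) * f y.

Definition subgrad (f : vec -> R) (x g : vec) : Prop :=
  forall y, f x + dotv g (y - x) <= f y.

Definition proper_fun (psi : vec -> \bar R) : Prop :=
  (exists x, psi x != +oo%E) /\ (forall x, psi x != -oo%E).

Definition closed_fun (psi : vec -> \bar R) : Prop :=
  closed [set p : vec * R | (psi p.1 <= p.2%:E)%E].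

Definition convex_efun (psi : vec -> \bar R) : Prop :=
  forall (x y : vec) (a b t : R), 0 <= t <= 1 ->
    psi x = a%:E -> psi y = b%:E ->
    (psi (t *: x + (1 - t) *: y)%R <= (t * a + (1 - t) * b)%:E)%E.

Definition esubgrad (psi : vec -> \bar R) (y g : vec) : Prop :=
  exists r : R, psi y = r%:E /\
    forall x, ((r + dotv g (x - y))%:E <= psi x)%E.

(* mu_psi-condition: B_psi(x,y) >= mu/2 ||x-y||^2 for all x, all y with nonempty
   subdifferential and every choice of subgradient at y *)
Definition mu_condition (psi : vec -> \bar R) (mu : R) : Prop :=
  0 <= mu /\ forall (x y g : vec), esubgrad psi y g ->
    forall r, psi y = r%:E ->
    ((r + dotv g (x - y) + mu / 2 * enorm (x - y) ^+ 2)%:E <= psi x)%E.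

Definition is_prox_step (n : nat) (psi : vec -> \bar R) (eta : R) (z x : vec) : Prop :=
  forall y, (n%:R%:E * psi x + (1 / (2 * eta) * enorm (x - z) ^+ 2)%:E
             <= n%:R%:E * psi y + (1 / (2 * eta) * enorm (y - z) ^+ 2)%:E)%E.

Fixpoint shuffle_pass (n : nat) (gf : 'I_n -> vec -> vec) (eta : R)
    (s : seq 'I_n) (x : vec) : vec :=
  match s with
  | [::] => x
  | i :: s' => shuffle_pass gf eta s' (x - eta *: gf i x)
  end.

Definition epoch_end (n : nat) (gf : 'I_n -> vec -> vec) (eta : R)
    (sigma : 'S_n) (x : vec) : vec :=
  shuffle_pass gf eta [seq sigma j | j <- enum 'I_n] x.

End Defs.

(* Main.v *)
(** Write [S] for the sum of the Lipschitz constants [G i]. Optimality of the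
    proximal step, strong convexity of [psi] and the subgradient inequalities along
    one epoch give, for every [y] in the domain of [psi],
    [n eta_k (F x_{k+1} - F y) <= |y - x_k|^2 / 2
       - (1 + n eta_k mu) / 2 * |y - x_{k+1}|^2 + 4 (eta_k S)^2].
    With [n eta_k mu = m / k], the weights [w_k = 'C(k+m-1, m) / k] make the distance
    terms telescope. Summing over [1 <= k <= K] with [y] the minimiser bounds the
    weighted average of the gaps; summing over [j <= k <= K] with [y = x_j] compares
    successive tail averages, the last of which is the last iterate. The total noise
    is of order [\sum_j w_j / (j W_j)] with [W_j = \sum_(k >= j) w_k]; as [w] is
    nondecreasing, [W_j >= (K + 1 - j) w_j], so this is at most
    [\sum_j 1 / (j (K + 1 - j))], i.e. [2 / (K + 1)] times the harmonic sum. *)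

Require Import Defs.
From HB Require Import structures.
From mathcomp Require Import all_boot all_order all_algebra all_fingroup.
From mathcomp Require Import all_classical all_reals all_analysis.
From mathcomp Require Import ring lra.
Import Order.TTheory GRing.Theory Num.Theory numFieldNormedType.Exports.
Local Open Scope ring_scope.

(** * The Euclidean inner product and norm on row vectors *)

Section EuclideanNorm.
Context {R : realType} {d : nat}.
Implicit Types (u v w : 'rV[R]_d) (a : R).

Lemma dotvC u v : dotv u v = dotv v u.
Proof. by apply: eq_bigr => j _; rewrite mulrC. Qed.

Lemma dotvDl u v w : dotv (u + v) w = dotv u w + dotv v w.
Proof. by rewrite /dotv -big_split; apply: eq_bigr => j _; rewrite mxE mulrDl. Qed.

Lemma dotvZl a u v : dotv (a *: u) v = a * dotv u v.
Proof. by rewrite /dotv big_distrr; apply: eq_bigr => j _; rewrite mxE /= mulrA. Qed.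

Lemma dotvNl u v : dotv (- u) v = - dotv u v.
Proof. by rewrite -scaleN1r dotvZl mulN1r. Qed.

Lemma dotvDr u v w : dotv u (v + w) = dotv u v + dotv u w.
Proof. by rewrite dotvC dotvDl !(dotvC u). Qed.

Lemma dotvZr a u v : dotv u (a *: v) = a * dotv u v.
Proof. by rewrite dotvC dotvZl dotvC. Qed.

Lemma dotvNr u v : dotv u (- v) = - dotv u v.
Proof. by rewrite dotvC dotvNl dotvC. Qed.

Lemma dot0v u : dotv 0 u = 0.
Proof. by rewrite -(scale0r u) dotvZl mul0r. Qed.

Definition dotvE := (dotvDl, dotvDr, dotvNl, dotvNr, dotvZl, dotvZr).

Lemma dotv_ge0 u : 0 <= dotv u u.
Proof. by apply: sumr_ge0 => j _; rewrite -expr2 sqr_ge0. Qed.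

Lemma enorm_ge0 u : 0 <= enorm u.
Proof. exact: sqrtr_ge0. Qed.

Lemma sqr_enorm u : enorm u ^+ 2 = dotv u u.
Proof. by rewrite sqr_sqrtr // dotv_ge0. Qed.

Lemma enormN u : enorm (- u) = enorm u.
Proof. by rewrite /enorm !dotvE opprK. Qed.

Lemma enorm_distC u v : enorm (u - v) = enorm (v - u).
Proof. by rewrite -enormN opprB. Qed.

Lemma enorm0 : enorm (0 : 'rV[R]_d) = 0.
Proof. by rewrite /enorm dot0v sqrtr0. Qed.

Lemma enormZ a u : enorm (a *: u) = `|a| * enorm u.
Proof.
by rewrite /enorm dotvZl dotvZr mulrA -expr2 sqrtrM ?sqr_ge0 // sqrtr_sqr.
Qed.

Lemma dotv0_enorm0 u v : enorm u = 0 -> dotv u v = 0.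
Proof.
move=> u0; have /eqP: dotv u u = 0 by rewrite -sqr_enorm u0 expr0n.
rewrite psumr_eq0 => [/allP uj0|j _]; last by rewrite -expr2 sqr_ge0.
apply: big1 => j _; move: (uj0 j (mem_index_enum _)).
by rewrite /= mulf_eq0 orbb => /eqP ->; rewrite mul0r.
Qed.

(** The squared norm of [|v| u - |u| v] is [2 |u| |v| (|u| |v| - <u, v>)]; once the degenerate cases
    are set aside, the positive factor cancels. *)
Lemma cauchy_schwarz u v : dotv u v <= enorm u * enorm v.
Proof.
have [u0|u0] := eqVneq (enorm u) 0; first by rewrite (dotv0_enorm0 _ v u0) u0 mul0r.
have [v0|v0] := eqVneq (enorm v) 0.
  by rewrite dotvC (dotv0_enorm0 _ u v0) v0 mulr0.
have uv_gt0 : 0 < enorm u * enorm v.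
  by rewrite mulr_gt0 // lt_neqAle eq_sym ?u0 ?v0 enorm_ge0.
have := dotv_ge0 (enorm v *: u - enorm u *: v).
rewrite !dotvE (dotvC v u) -!sqr_enorm => sq_ge0.
rewrite -(ler_pM2l uv_gt0); lra.
Qed.

Lemma ler_enormD u v : enorm (u + v) <= enorm u + enorm v.
Proof.
rewrite -[leRHS]ger0_norm ?addr_ge0 ?enorm_ge0 // -sqrtr_sqr ler_wsqrtr //.
rewrite !dotvE (dotvC v u) -!sqr_enorm; have := cauchy_schwarz u v; lra.
Qed.

End EuclideanNorm.

(** * Subgradient steps within one epoch *)

Section SubgradientPass.
Context {R : realType} {d n : nat}.
Variables (f : 'I_n -> 'rV[R]_d -> R) (gf : 'I_n -> 'rV[R]_d -> 'rV[R]_d).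
Variable G : 'I_n -> R.
Hypothesis gfP : forall i y, subgrad (f i) y (gf i y).
Hypothesis G_ge0 : forall i, 0 <= G i.
Hypothesis gf_le : forall i y, enorm (gf i y) <= G i.

Lemma subgrad_lipschitz i u v : f i u - f i v <= G i * enorm (u - v).
Proof.
have := gfP i u v; rewrite -(opprB u v) dotvNr.
have := cauchy_schwarz (gf i u) (u - v).
have := ler_wpM2r (enorm_ge0 (u - v)) (gf_le i u); lra.
Qed.

(** Induction on the pass. Moving from the current point to [u] costs [2 * G i] times their
    distance, once for the value of [f i] and once for the inner product. That distance grows by at
    most [eta * G i] per step, and the accumulated drift fits into the square term. *)
Lemma shuffle_pass_le (eta : R) (s : seq 'I_n) (x y u : 'rV[R]_d) : 0 <= eta ->
  dotv (x - shuffle_pass gf eta s x) (y - u) <=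
    eta * (\sum_(i <- s) f i y - \sum_(i <- s) f i u)
    + 2 * eta * (\sum_(i <- s) G i) * enorm (u - x)
    + 2 * (eta * \sum_(i <- s) G i) ^+ 2.
Proof.
move=> eta_ge0; elim: s x => [|i s IHs] x /=.
  by rewrite !big_nil (subrr x) dot0v; lra.
rewrite !big_cons; have := IHs (x - eta *: gf i x).
set z := shuffle_pass _ _ _ _; set S := \sum_(j <- s) G j.
have S_ge0 : 0 <= S by apply: sumr_ge0.
have -> : x - z = (x - eta *: gf i x - z) + eta *: gf i x by rewrite addrAC subrK.
move=> IH; rewrite dotvDl dotvZl.
have gyu : dotv (gf i x) (y - u) <= f i y - f i u + 2 * G i * enorm (u - x).
  have -> : y - u = (y - x) - (u - x) by rewrite opprB addrA subrK.
  rewrite dotvDr dotvNr; have := gfP i x y; have := subgrad_lipschitz i u x.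
  have := cauchy_schwarz (gf i x) (x - u); rewrite -(opprB u x) dotvNr enormN.
  have := ler_wpM2r (enorm_ge0 (u - x)) (gf_le i x); lra.
have ux : enorm (u - (x - eta *: gf i x)) <= enorm (u - x) + eta * G i.
  rewrite opprB addrCA addrC; apply: le_trans (ler_enormD _ _) _.
  by rewrite enormZ ger0_norm // lerD2l ler_wpM2l.
have := ler_wpM2l eta_ge0 gyu.
have := ler_wpM2l (mulr_ge0 eta_ge0 S_ge0) ux.
have := mulr_ge0 (mulr_ge0 eta_ge0 eta_ge0) (mulr_ge0 (G_ge0 i) S_ge0).
have := mulr_ge0 (mulr_ge0 eta_ge0 eta_ge0) (mulr_ge0 (G_ge0 i) (G_ge0 i)).
lra.
Qed.

Lemma epoch_end_le (eta : R) (sigma : 'S_n) (x y u : 'rV[R]_d) : 0 <= eta ->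
  dotv (x - epoch_end gf eta sigma x) (y - u) <=
    eta * (\sum_(i < n) f i y - \sum_(i < n) f i u)
    + 2 * eta * (\sum_(i < n) G i) * enorm (u - x)
    + 2 * (eta * \sum_(i < n) G i) ^+ 2.
Proof.
have sumE (h : 'I_n -> R) :
    \sum_(i <- [seq sigma j | j <- enum 'I_n]) h i = \sum_(i < n) h i.
  by rewrite big_map big_enum [RHS](reindex_inj (@perm_inj _ sigma)).
by rewrite -!sumE; apply: shuffle_pass_le.
Qed.

End SubgradientPass.

(** Replaces a limit [t -> 0]: if [a < 0], then [t = - a / (2 (|b| - a))] gives
    [a + t b <= a / 2 + t a < 0]. *)
Lemma ge0_of_small_affine (R : realType) (a b : R) :
  (forall t, 0 < t <= 1 -> 0 <= a + t * b) -> 0 <= a.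
Proof.
move=> ab_ge0; rewrite leNgt; apply/negP => a_lt0.
have c_gt0 : 0 < `|b| - a by rewrite subr_gt0 (lt_le_trans a_lt0).
pose t := - a / (`|b| - a) / 2.
have tE : t * (`|b| - a) * 2 = - a by rewrite /t; field; apply/lt0r_neq0.
have t_gt0 : 0 < t by rewrite /t !mulr_gt0 ?invr_gt0 // oppr_gt0.
have bn := ler_norm b; have b_ge0 := normr_ge0 b.
have tb := ler_wpM2l (ltW t_gt0) bn.
have t_le1 : t <= 1 by rewrite -(ler_pM2r c_gt0); nra.
have := ab_ge0 t; rewrite t_gt0 t_le1 => /(_ isT).
have ta : t * a < 0 by rewrite pmulr_rlt0.
nra.
Qed.

(** * Optimality of the proximal step *)

Section ProximalStep.
Context {R : realType} {d n : nat}.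
Variables (psi : 'rV[R]_d -> \bar R) (eta : R) (z x : 'rV[R]_d).
Hypotheses (n_gt0 : (0 < n)%N) (eta_gt0 : 0 < eta).
Hypotheses (psi_proper : proper_fun psi) (psi_convex : convex_efun psi).
Hypothesis prox : is_prox_step n psi eta z x.

Lemma prox_step_fin : exists r, psi x = r%:E.
Proof.
have [[y]] := psi_proper; have := prox y.
case: psi_proper => _ /[dup] /(_ y) + /(_ x).
case: (psi y) => [s||] // _; case: (psi x) => [r||] // _; first by exists r.
(* Positivity of [n] matters: [n * +oo] is [+oo], while [0 * +oo] would be [0]. *)
by rewrite gt0_muley ?lte_fin ?ltr0n // -EFinM.
Qed.

(** First-order optimality by hand: compare [x] with [t y + (1 - t) x], use convexity of [psi],
    divide by [t] and let [t] tend to 0. The quadratic term leaves the remainder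
    [t |y - x|^2 / 2]. *)
Lemma prox_step_esubgrad : esubgrad psi x ((n%:R * eta)^-1 *: (z - x)).
Proof.
have [r psix] := prox_step_fin; exists r; split=> // y.
have := psi_proper.2 y; case psiy: (psi y) => [s||] // _; last by rewrite leey.
have n0 : 0 < n%:R :> R by rewrite ltr0n.
rewrite lee_fin dotvZl -subr_ge0.
suff : 0 <= n%:R * eta * (s - r) - dotv (z - x) (y - x).
  rewrite -(pmulr_rge0 _ (mulr_gt0 n0 eta_gt0)); congr (_ <= _); field.
  by rewrite !gt_eqF.
apply: (@ge0_of_small_affine _ _ (dotv (y - x) (y - x) / 2)) => t /andP[t0 t1].
have t01 : 0 <= t <= 1 by rewrite ltW.
have := psi_convex y x s r t t01 psiy psix; have := prox (t *: y + (1 - t) *: x).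
have := psi_proper.2 (t *: y + (1 - t) *: x).
case: (psi (t *: y + _)) => [q||] // _; rewrite psix -!EFinM -!EFinD !lee_fin.
have -> : t *: y + (1 - t) *: x - z = t *: (y - x) - (z - x).
  by apply/matrixP => i j; rewrite !mxE; ring.
rewrite (enorm_distC x z) !sqr_enorm.
move: (y - x) (z - x) => v w; rewrite !dotvE (dotvC v w) => Hprox Hq.
have {}Hprox : 2 * eta * (n%:R * r) + dotv w w <=
    2 * eta * (n%:R * q) + (t * (t * dotv v v) - 2 * t * dotv w v + dotv w w).
  have e2 : 0 < 2 * eta by rewrite mulr_gt0.
  rewrite -(ler_pM2l e2) in Hprox; move: Hprox; congr (_ <= _); field; exact: lt0r_neq0.
have := ler_wpM2l (ltW (mulr_gt0 n0 eta_gt0)) Hq => {}Hq.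
rewrite -(pmulr_rge0 _ t0); lra.
Qed.

Lemma prox_step_le (mu : R) (y : 'rV[R]_d) (r s : R) : mu_condition psi mu ->
  psi x = r%:E -> psi y = s%:E ->
  dotv (z - x) (y - x) + n%:R * eta * mu / 2 * enorm (y - x) ^+ 2
    <= n%:R * eta * (s - r).
Proof.
move=> [_ /(_ y x _ prox_step_esubgrad) mu_le] psix psiy.
have := mu_le _ psix; rewrite psiy lee_fin dotvZl.
have ne_gt0 : 0 < n%:R * eta by rewrite mulr_gt0 // ltr0n.
rewrite -(ler_pM2l ne_gt0) => H; rewrite -subr_ge0; rewrite -subr_ge0 in H.
by move: H; congr (_ <= _); field; rewrite !gt_eqF // ltr0n.
Qed.

End ProximalStep.

(** Add [epoch_end_le] at [u = x'] to [prox_step_le]: the terms in [z] cancel, and polarisation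
    yields the squared distances and a spare [- |x' - x|^2 / 2]. *)
Lemma epoch_step_le (R : realType) (d n : nat) (f : 'I_n -> 'rV[R]_d -> R)
    (gf : 'I_n -> 'rV[R]_d -> 'rV[R]_d) (G : 'I_n -> R) (psi : 'rV[R]_d -> \bar R)
    (mu eta : R) (sigma : 'S_n) (x x' y : 'rV[R]_d) (r s : R) :
  (0 < n)%N -> 0 < eta ->
  (forall i y, subgrad (f i) y (gf i y)) -> (forall i, 0 <= G i) ->
  (forall i y, enorm (gf i y) <= G i) ->
  proper_fun psi -> convex_efun psi -> mu_condition psi mu ->
  is_prox_step n psi eta (epoch_end gf eta sigma x) x' ->
  psi x' = r%:E -> psi y = s%:E ->
  n%:R * eta * ((n%:R^-1 * (\sum_(i < n) f i x') + r)
                - (n%:R^-1 * (\sum_(i < n) f i y) + s))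
  <= enorm (y - x) ^+ 2 / 2 - (1 + n%:R * eta * mu) / 2 * enorm (y - x') ^+ 2
     + 4 * (eta * \sum_(i < n) G i) ^+ 2.
Proof.
move=> n_gt0 eta_gt0 gfP G_ge0 gf_le psi_proper psi_convex psi_mu prox psix psiy.
have n0 : n%:R != 0 :> R by rewrite pnatr_eq0 -lt0n.
have := prox_step_le _ _ _ _ n_gt0 eta_gt0 psi_proper psi_convex prox _ _ _ _ psi_mu psix psiy.
have := epoch_end_le _ _ _ gfP G_ge0 gf_le eta sigma x y x' (ltW eta_gt0).
move: (epoch_end _ _ _ _) => z.
set S := \sum_(i < n) G i; set fx := \sum_(i < n) f i x'; set fy := \sum_(i < n) f i y.
have -> : n%:R * eta * (n%:R^-1 * fx + r - (n%:R^-1 * fy + s)) =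
    eta * (fx - fy) - n%:R * eta * (s - r) by field.
have -> : x - z = (y - x') - (y - x) - (z - x').
  by apply/matrixP => i j; rewrite !mxE; ring.
have -> : x' - x = (y - x) - (y - x') by apply/matrixP => i j; rewrite !mxE; ring.
have := sqr_enorm ((y - x) - (y - x')); move: (enorm _) => a.
rewrite !sqr_enorm; move: (y - x) (y - x') (z - x') => u v w.
rewrite !dotvE (dotvC v u).
(* With [a = |x' - x|], [2 eta S a <= a^2 / 2 + 2 (eta S)^2]. The spare square absorbs [a^2 / 2];
   the rest raises the noise constant from 2 to 4. *)
have := sqr_ge0 (a - 2 * eta * S); lra.
Qed.

(** * From weighted averages to the last iterate *)

Section LastIterate.
Context {R : realType}.
Variables (w a Delta : nat -> R) (B : R) (K : nat).
Hypothesis w_gt0 : forall k, (0 < k)%N -> 0 < w k.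

Local Notation W j := (\sum_(j <= k < K.+1) w k).
Local Notation A j := (\sum_(j <= k < K.+1) a k).
Local Notation T j := (\sum_(j <= k < K.+1) w k * Delta k.+1).

Lemma weight_tail_gt0 j : (0 < j <= K)%N -> 0 < W j.
Proof.
move=> /andP[j0 jK]; rewrite big_ltn // ltr_pwDl ?w_gt0 //.
rewrite big_nat_cond sumr_ge0 // => k /andP[/andP[jk _] _].
exact/ltW/w_gt0/(leq_ltn_trans _ jk).
Qed.

Hypothesis avg_le : T 1 <= B + A 1.
Hypothesis tail_le : forall j, (1 < j <= K)%N -> T j - W j * Delta j <= A j.

(* The tail averages [T j / W j] interpolate between the full average ([j = 1])
   and the last iterate ([j = K]); [tail_le] bounds the cost of each step. *)
Lemma tail_average_le j : (0 < j <= K)%N ->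
  T j / W j <= B / W 1 + A j / W j + \sum_(1 <= i < j) a i / W i.
Proof.
case: j => // j; elim: j => [/= K0|j IHj /= jK].
  rewrite [\sum_(1 <= i < 1) _]big_geq // addr0 -mulrDl ler_pM2r ?invr_gt0 //.
  exact: weight_tail_gt0.
have W1 : 0 < W j.+1 by apply: weight_tail_gt0; rewrite /= ltnW.
have W2 : 0 < W j.+2 by apply: weight_tail_gt0.
have {}IHj := IHj (ltnW jK); rewrite [\sum_(1 <= i < j.+2) _]big_nat_recr //=.
have TE : T j.+1 = w j.+1 * Delta j.+2 + T j.+2 by rewrite big_ltn // ltnS ltnW.
have AE : A j.+1 = a j.+1 + A j.+2 by rewrite big_ltn // ltnS ltnW.
have WE : W j.+1 = w j.+1 + W j.+2 by rewrite big_ltn // ltnS ltnW.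
have wj := w_gt0 j.+1 isT; have tail := tail_le j.+2 jK.
suff : T j.+2 / W j.+2 - T j.+1 / W j.+1 <= A j.+2 / W j.+2 - A j.+2 / W j.+1.
  rewrite AE mulrDl in IHj; lra.
rewrite -subr_ge0.
(* The gap between the two sides is a positive multiple of the slack in [tail_le] at [j.+2]. *)
have -> : A j.+2 / W j.+2 - A j.+2 / W j.+1 - (T j.+2 / W j.+2 - T j.+1 / W j.+1) =
    w j.+1 / (W j.+1 * W j.+2) * (A j.+2 - (T j.+2 - W j.+2 * Delta j.+2)).
  rewrite TE; move: W1; rewrite WE => W1; field.
  by rewrite !gt_eqF.
by rewrite mulr_ge0 ?subr_ge0 // divr_ge0 ?mulr_ge0 // ltW.
Qed.

Lemma last_iterate_le : (0 < K)%N ->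
  Delta K.+1 <= B / W 1 + \sum_(1 <= i < K.+1) a i / W i.
Proof.
move=> K0; have := tail_average_le K; rewrite K0 leqnn => /(_ isT).
rewrite [\sum_(1 <= i < K.+1) a i / _]big_nat_recr //=.
have -> : T K = w K * Delta K.+1 by rewrite big_nat1.
have -> : A K = a K by rewrite big_nat1.
have WK : W K = w K by rewrite big_nat1.
rewrite {1}WK mulrAC divff ?mul1r; first by lra.
exact/lt0r_neq0/w_gt0.
Qed.

End LastIterate.

(** * Binomial weights and telescoping *)

Section BinomialWeights.
Context {R : realType}.
Variable m : nat.
Hypothesis m_gt0 : (0 < m)%N.

(* The weights are chosen so that [k w_k |y - x_k|^2 - (k + m) w_k |y - x_{k+1}|^2]
   telescopes. *)
Definition binw (k : nat) : R := 'C((k + m).-1, m)%:R / k%:R.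

Lemma binw_gt0 k : (0 < k)%N -> 0 < binw k.
Proof.
move=> k0; rewrite divr_gt0 ?ltr0n // bin_gt0 -ltnS prednK ?addn_gt0 ?k0 //.
by rewrite -add1n leq_add2r.
Qed.

Lemma mul_binw k : (0 < k)%N -> k%:R * binw k = 'C((k + m).-1, m)%:R.
Proof. by move=> k0; rewrite mulrC divfK // pnatr_eq0 -lt0n. Qed.

Lemma binwS k : (0 < k)%N -> k.+1%:R * binw k.+1 = (k + m)%:R * binw k.
Proof.
move=> k0; rewrite mul_binw // addSn /=.
have k0' : k%:R != 0 :> R by rewrite pnatr_eq0 -lt0n.
apply: (mulfI k0'); rewrite -natrM mulrCA mul_binw // -natrM mul_bin_down.
by rewrite addnK.
Qed.

Lemma binw1 : binw 1 = 1.
Proof. by rewrite /binw add1n /= binn divr1. Qed.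

Lemma binw_leS k : (0 < k)%N -> binw k <= binw k.+1.
Proof.
move=> k0; rewrite -(@ler_pM2l _ k.+1%:R) ?ltr0n // binwS // ler_pM2r ?binw_gt0 //.
by rewrite ler_nat -addn1 leq_add2l.
Qed.

Lemma binw_le j k : (0 < j)%N -> (j <= k)%N -> binw j <= binw k.
Proof.
move=> j0; elim: k => [|k IHk]; first by rewrite leqn0 => /eqP ->.
rewrite leq_eqVlt ltnS => /predU1P[-> //|jk].
by apply: le_trans (IHk jk) _; apply: binw_leS; apply: leq_trans jk.
Qed.

(** By [binwS], [m * binw k] is the increment of [k * binw k]. *)
Lemma sum_binw K : m%:R * \sum_(1 <= k < K.+1) binw k = 'C(K + m, m)%:R - 1.
Proof.
have -> : 'C(K + m, m)%:R - 1 = K.+1%:R * binw K.+1 - 1%:R * binw 1 :> R.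
  by rewrite mul_binw // binw1 mul1r addSn.
rewrite -(telescope_sumr (fun k => k%:R * binw k)) // mulr_sumr.
rewrite !big_nat; apply: eq_bigr => k /andP[k0 _].
by rewrite binwS // natrD mulrDl [k%:R * _ + _]addrC addrK.
Qed.

Lemma binw_tail_ge j K : (0 < j)%N ->
  (K.+1 - j)%:R * binw j <= \sum_(j <= k < K.+1) binw k.
Proof.
move=> j0; rewrite mulr_natl -sumr_const_nat !big_nat.
by apply: ler_sum => k /andP[jk _]; apply: binw_le.
Qed.

(** Here [q k] stands for [|y - x_k|^2] and [F] for the value at the reference point [y], so that
    one statement serves both [y = xstar] and [y = x j]. *)
Lemma sum_binw_telescope (c E F : R) (q D : nat -> R) (j K : nat) :
  0 <= c -> (forall k, 0 <= q k) -> (0 < j <= K)%N ->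
  (forall k, (j <= k <= K)%N ->
     D k.+1 - F <= c * (k%:R * q k - (k + m)%:R * q k.+1) + E / k%:R) ->
  \sum_(j <= k < K.+1) binw k * (D k.+1 - F)
    <= c * (j%:R * binw j * q j) + \sum_(j <= k < K.+1) E * binw k / k%:R.
Proof.
move=> c_ge0 q_ge0 /andP[j0 jK] D_le.
pose u k := - (c * (k%:R * binw k * q k)).
have step k : (j <= k < K.+1)%N ->
    binw k * (D k.+1 - F) <= (u k.+1 - u k) + E * binw k / k%:R.
  rewrite ltnS => /[dup] /andP[jk _] /D_le.
  have k0 : (0 < k)%N by apply: leq_trans jk.
  move=> /(ler_wpM2l (ltW (binw_gt0 k k0))) /le_trans -> //.
  by rewrite /u binwS // le_eqVlt; apply/orP; left; apply/eqP; ring.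
rewrite big_nat; apply: le_trans (ler_sum _ step) _.
rewrite -big_nat big_split /= lerD2r telescope_sumr; last by apply: leqW.
(* The boundary term at [K.+1] enters with a minus sign and is dropped. *)
have := mulr_ge0 c_ge0 (mulr_ge0 (mulr_ge0 (ler0n R K.+1) (ltW (binw_gt0 K.+1 isT))) (q_ge0 K.+1)).
by rewrite /u; lra.
Qed.

End BinomialWeights.

(** * Harmonic sums and the logarithm *)

Section Harmonic.
Context {R : realType}.

(** This is [ln (1 + t) <= t] at [t = - 1 / (k + 1)]. *)
Lemma invS_le_ln k : (0 < k)%N -> k.+1%:R^-1 <= ln k.+1%:R - ln k%:R :> R.
Proof.
move=> k0; have k0' : 0 < k%:R :> R by rewrite ltr0n.
rewrite -lerN2 opprB -ln_div ?posrE //.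
have -> : k%:R / k.+1%:R = 1 + - k.+1%:R^-1 :> R.
  by rewrite -natr1; field; rewrite natr1 pnatr_eq0.
apply: le_ln1Dx; rewrite ltrN2 invf_lt1 ?ltr0n // ltr1n.
by rewrite ltnS.
Qed.

Lemma harmonic_le K : (0 < K)%N ->
  \sum_(1 <= k < K.+1) k%:R^-1 <= 1 + ln K%:R :> R.
Proof.
case: K => // K _; elim: K => [|K IHK]; first by rewrite big_nat1 invr1 ln1 addr0.
rewrite big_nat_recr //=; apply: le_trans (lerD IHK (invS_le_ln K.+1 isT)) _.
by rewrite -addrA subrKC.
Qed.

Lemma ln_nat_ge_half K : (2 <= K)%N -> 2^-1 <= ln K%:R :> R.
Proof.
move=> K2; apply: le_trans (_ : ln 2 <= _).
  by have := invS_le_ln 1 isT; rewrite ln1 subr0.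
by rewrite ler_ln ?posrE ?ltr0n ?ler_nat // (leq_trans _ K2).
Qed.

(** Partial fractions give two harmonic sums, equal after reversing the index. *)
Lemma sum_inv_mul_rev K :
  \sum_(1 <= j < K.+1) (j%:R * (K.+1 - j)%:R)^-1
    = 2 / K.+1%:R * \sum_(1 <= j < K.+1) j%:R^-1 :> R.
Proof.
transitivity (K.+1%:R^-1 *
    \sum_(1 <= j < K.+1) (j%:R^-1 + (K.+1 - j)%:R^-1) :> R).
  rewrite mulr_sumr !big_nat; apply: eq_bigr => j /andP[j0 jK].
  rewrite -[in K.+1%:R^-1](subnKC (ltnW jK)) natrD; field.
  by rewrite -natrD !pnatr_eq0 addn_eq0 -!lt0n negb_and -!lt0n subn_gt0 j0 jK.
rewrite big_split /= [X in _ + X](_ : _ = \sum_(1 <= j < K.+1) j%:R^-1).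
  by ring.
rewrite big_nat_rev /= !big_nat; apply: eq_bigr => j /andP[j0 jK].
by rewrite add1n subSS subKn // ltnW.
Qed.

End Harmonic.

Theorem theorem4p5 (R : realType) :
  exists C : R, 0 < C /\
  forall (d n : nat) (f : 'I_n -> 'rV[R]_d -> R) (gf : 'I_n -> 'rV[R]_d -> 'rV[R]_d)
    (psi : 'rV[R]_d -> \bar R) (mu : R) (G : 'I_n -> R)
    (xstar : 'rV[R]_d) (Fstar : R)
    (m K : nat) (eta : nat -> R) (sigma : nat -> 'S_n) (x : nat -> 'rV[R]_d),
  (0 < n)%N ->
  (forall i, convex_fun (f i)) ->
  (forall i y, subgrad (f i) y (gf i y)) ->
  proper_fun psi -> closed_fun psi -> convex_efun psi ->
  (* F = f + psi attains its infimum F_* at xstar *)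
  ((n%:R^-1 * \sum_(i < n) f i xstar)%:E + psi xstar = Fstar%:E)%E ->
  (forall y, (Fstar%:E <= (n%:R^-1 * \sum_(i < n) f i y)%:E + psi y)%E) ->
  (* Lipschitz condition *)
  (forall i, 0 < G i) ->
  (forall i y g, subgrad (f i) y g -> enorm g <= G i) ->
  (* mu_psi-condition with mu_psi > 0 *)
  mu_condition psi mu -> 0 < mu ->
  (* the method *)
  (0 < m)%N -> (2 <= K)%N ->
  psi (x 1%N) != +oo%E ->
  (forall k, (1 <= k <= K)%N -> eta k = m%:R / (n%:R * mu * k%:R)) ->
  (forall k, (1 <= k <= K)%N ->
     is_prox_step n psi (eta k) (epoch_end gf (eta k) (sigma k) (x k)) (x k.+1)) ->
  ((n%:R^-1 * \sum_(i < n) f i (x K.+1))%:E + psi (x K.+1)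
    <= (Fstar + C * (mu * enorm (xstar - x 1%N) ^+ 2 / 'C(K + m, m)%:R
         + (n%:R^-1 * \sum_(i < n) G i) ^+ 2 * m%:R * ln K%:R / (mu * K%:R)))%:E)%E.
Proof.
(* [24 = 4 * 2 * 3]: the noise constant of one epoch, the two harmonic sums, and
   [1 + ln K <= 3 ln K]. *)
exists 24; split=> // d n f gf psi mu G xstar Fstar m K eta sigma x.
move=> n_gt0 _ gfP psi_proper _ psi_convex FstarE _ G_gt0 G_le psi_mu mu_gt0.
move=> m_gt0 K_ge2 _ etaE prox.
have K_gt0 : (0 < K)%N by apply: leq_trans K_ge2.
have n0 : 0 < n%:R :> R by rewrite ltr0n.
have m0 : 0 < m%:R :> R by rewrite ltr0n.
have K0 : 0 < K%:R :> R by rewrite ltr0n.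
have eta_gt0 k : (0 < k <= K)%N -> 0 < eta k.
  move=> kK; rewrite etaE // divr_gt0 // !mulr_gt0 // ltr0n.
  by case/andP: kK.
pose favg y := n%:R^-1 * \sum_(i < n) f i y.
(* [fine] loses nothing: only [F k] with [k > 1] enters the bounds, and there [psi (x k)] is
   finite. *)
pose F k := favg (x k) + fine (psi (x k)).
have psi_fin k : (1 < k <= K.+1)%N -> psi (x k) = (fine (psi (x k)))%:E.
  case: k => // k kK; have [r ->//] :=
    prox_step_fin _ _ _ _ n_gt0 psi_proper (prox k kK).
have [s psis] : exists s, psi xstar = s%:E.
  by move: FstarE; case: (psi xstar) => [s||] //; exists s.
have Fs : favg xstar + s = Fstar by move: FstarE; rewrite psis -EFinD => -[].
pose S := \sum_(i < n) G i.
(* [E / k] and [c] result from dividing the epoch inequality by [n * eta k = m / (mu * k)]. *)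
pose E := 4 * m%:R * (n%:R^-1 * S) ^+ 2 / mu.
pose c := mu / (2 * m%:R).
have c_ge0 : 0 <= c by rewrite divr_ge0 ?mulr_ge0 ?ltW.
have step k y r : (0 < k <= K)%N -> psi y = r%:E ->
    F k.+1 - (favg y + r) <= c * (k%:R * enorm (y - x k) ^+ 2
      - (k + m)%:R * enorm (y - x k.+1) ^+ 2) + E / k%:R.
  move=> kK psiy; have k0 : 0 < k%:R :> R by rewrite ltr0n; case/andP: kK.
  have Hk := psi_fin k.+1 kK.
  have := epoch_step_le _ _ _ _ _ G _ _ _ _ _ _ _ _ _ n_gt0 (eta_gt0 k kK) gfP
    (fun i => ltW (G_gt0 i)) (fun i y => G_le i y _ (gfP i y)) psi_proper psi_convex
    psi_mu (prox k kK) Hk psiy.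
  rewrite -/(favg _) -/(favg y) -/(F k.+1) -/S etaE // => H.
  have muk_gt0 : 0 < mu * k%:R / m%:R by rewrite divr_gt0 ?mulr_gt0.
  have := ler_wpM2l (ltW muk_gt0) H; rewrite -subr_ge0 => {}H.
  rewrite -subr_ge0; move: H; congr (_ <= _); rewrite /c /E natrD; field.
  by rewrite !gt_eqF.
have avg_le : \sum_(1 <= k < K.+1) binw m k * (F k.+1 - Fstar)
    <= c * enorm (xstar - x 1%N) ^+ 2 + \sum_(1 <= k < K.+1) E * binw m k / k%:R.
  have := sum_binw_telescope m c E Fstar (fun k => enorm (xstar - x k) ^+ 2) F 1 K c_ge0.
  rewrite binw1 !mul1r; apply=> // [k|k kK]; first exact: sqr_ge0.
  by rewrite -Fs; apply: step.
have tail_le j : (1 < j <= K)%N ->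
    \sum_(j <= k < K.+1) binw m k * (F k.+1 - Fstar)
      - (\sum_(j <= k < K.+1) binw m k) * (F j - Fstar)
    <= \sum_(j <= k < K.+1) E * binw m k / k%:R.
  move=> /andP[j1 jK].
  have := sum_binw_telescope m c E (F j) (fun k => enorm (x j - x k) ^+ 2) F j K c_ge0.
  (* The reference point is [x j] itself, so the initial distance vanishes. *)
  rewrite subrr enorm0 expr0n mulr0 mulr0 add0r mulr_suml -sumrB => H.
  under eq_bigr do rewrite -mulrBr opprB addrA subrK.
  apply: H => [k||k /andP[jk kK]]; first exact: sqr_ge0.
    by rewrite jK (ltnW j1).
  apply: step; first by rewrite kK andbT (leq_trans _ jk) // ltnW.
  by apply: psi_fin; rewrite j1 leqW.
have := last_iterate_le (binw m) (fun k => E * binw m k / k%:R) (fun k => F k - Fstar)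
  (c * enorm (xstar - x 1%N) ^+ 2) K (binw_gt0 m) avg_le tail_le K_gt0.
set D2 := enorm _ ^+ 2 => last_le.
rewrite (psi_fin K.+1) ?ltnS ?K_gt0 ?leqnn // -EFinD lee_fin -/(favg _) -/(F _) -lerBlDl.
apply: le_trans last_le _; rewrite mulrDr; apply: lerD.
  have D2_ge0 : 0 <= D2 by apply: sqr_ge0.
  have := @sum_binw R m K; have := @binw_tail_ge R m m_gt0 1 K isT.
  rewrite binw1 mulr1 subn1 /=.
  move: ('C(K + m, m)%:R : R) (\sum_(_ <= _ < _) _) => N W W_ge NE.
  have W_gt0 : 0 < W by apply: lt_le_trans W_ge.
  have K2 : 2 <= K%:R :> R by rewrite ler_nat.
  (* [N - 1 = m W >= W >= K >= 2], so replacing [N - 1] by [N] costs only a bounded factor. *)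
  have N_ge : 2 <= N - 1.
    by rewrite -NE (le_trans K2) // (le_trans W_ge) // ler_peMl ?ler1n // ltW.
  have -> : c * D2 / W = mu * D2 / (2 * (N - 1)).
    by rewrite -NE /c; field; rewrite !gt_eqF.
  have -> : 24 * (mu * D2 / N) = mu * D2 * (24 / N) by ring.
  apply: ler_wpM2l; first by rewrite mulr_ge0 // ltW.
  rewrite ler_pdivlMr; last by lra.
  by rewrite mulrC ler_pdivrMr; lra.
have E_ge0 : 0 <= E.
  by rewrite divr_ge0 ?(ltW mu_gt0) // mulr_ge0 ?sqr_ge0 // mulr_ge0.
have lnK := @ln_nat_ge_half R K K_ge2.
apply: le_trans (_ : E * \sum_(1 <= j < K.+1) (j%:R * (K.+1 - j)%:R)^-1 <= _).
  rewrite mulr_sumr !big_nat; apply: ler_sum => j /andP[j_gt0 jK].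
  have j0 : 0 < j%:R :> R by rewrite ltr0n.
  have jK0 : 0 < (K.+1 - j)%:R :> R by rewrite ltr0n subn_gt0.
  have := @binw_gt0 R m j j_gt0; have := @binw_tail_ge R m m_gt0 j K j_gt0.
  move: (E) E_ge0 (binw m j) (\sum_(_ <= _ < _) _) => E' E'_ge0 w W wW w_gt0.
  rewrite -!mulrA ler_wpM2l // invfM mulrCA ler_pM2l ?invr_gt0 //.
  rewrite ler_pdivrMr; last by apply: lt_le_trans wW; rewrite mulr_gt0.
  by rewrite mulrC ler_pdivlMr // mulrC.
rewrite sum_inv_mul_rev.
(* Since [ln K >= 1 / 2], the 1 in the harmonic bound is at most [2 ln K]. *)
apply: le_trans (_ : E * (2 / K%:R * (3 * ln K%:R)) <= _).
  rewrite ler_wpM2l // ler_pM ?sumr_ge0 //.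
  - by rewrite ler_wpM2l // lef_pV2 ?posrE ?ltr0n // ler_nat.
  - by apply: le_trans (harmonic_le K K_gt0) _; lra.
rewrite le_eqVlt; apply/orP; left; apply/eqP; rewrite /E /S; field.
by rewrite !gt_eqF.
Qed.
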